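(* Let $H$ be a cocommutative Hopf algebra over a field $k$ and let $A$ be a commutative unital $k$-algebra with a partial action of $H$. For any $n\ge 0$ and any $f\in C^n_{par}(H,A)$, the linear map $\delta_n(f):H^{\otimes n+1}\to A$ is an element of $C^{n+1}_{par}(H,A)$. Moreover, the map $\delta_n:C^n_{par}(H,A)\to C^{n+1}_{par}(H,A)$ is a morphism of abelian groups.
   Context: $k$ is a field; Sweedler notation is used and $\epsilon$ is the counit of $H$. A partial action of $H$ on a unital algebra $A$ is a linear map $\cdot:H\otimes A\to A$ such that for all $a,b\in A$, $h,l\in H$: (PA1) $1_H\cdot a=a$; (PA2) $h\cdot(ab)=(h_{(1)}\cdot a)(h_{(2)}\cdot b)$; (PA3) $h\cdot(l\cdot a)=(h_{(1)}\cdot 1_A)(h_{(2)}l\cdot a)$. For $n\ge 0$, $\mathrm{Hom}_k(H^{\otimes n},A)$ is the convolution algebra with product $(f*g)(h^1,\ldots,h^n)=f(h^1_{(1)},\ldots,h^n_{(1)})\,g(h^1_{(2)},\ldots,h^n_{(2)})$ (where $f(h^1,\ldots,h^n)$ means $f(h^1\otimes\cdots\otimes h^n)$) and unit $\epsilon(h^1)\cdots\epsilon(h^n)1_A$; it is commutative because $H$ is cocommutative and $A$ is commutative. For $n=0$ it is identified with $A$. For $1\le l\le n$ put $\widetilde e_{l,n}(h^1,\ldots,h^n)=((h^1\cdots h^l)\cdot 1_A)\,\epsilon(h^{l+1})\cdots\epsilon(h^n)$ and $e_n=\widetilde e_{1,n}*\widetilde e_{2,n}*\cdots*\widetilde e_{n,n}$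 (an idempotent); $e_0=1_A$. For $n\ge 1$ let $I(H^{\otimes n},A)=e_n*\mathrm{Hom}_k(H^{\otimes n},A)$, an ideal which is a unital algebra with unit $e_n$, and let $C^n_{par}(H,A)=(I(H^{\otimes n},A))^{\times}$ be its group of invertible elements (inverse taken with respect to $e_n$); $C^0_{par}(H,A)=A^\times$. The inverse of $f$ in $C^n_{par}(H,A)$ is denoted $f^{-1}$. For $n\ge 1$ and $f\in C^n_{par}(H,A)$ the coboundary is $$(\delta_nf)(h^1,\ldots,h^{n+1})=\big(h^1_{(1)}\cdot f(h^2_{(1)},\ldots,h^{n+1}_{(1)})\big)\prod_{i=1}^n f^{(-1)^i}(h^1_{(i+1)},\ldots,h^i_{(i+1)}h^{i+1}_{(i+1)},\ldots,h^{n+1}_{(i+1)})\; f^{(-1)^{n+1}}(h^1_{(n+2)},\ldots,h^n_{(n+2)})$$ (with the last tensorand $h^{n+1}$ in the final factor absorbed by $\epsilon$), and $(\delta_0a)(h)=(h\cdot a)a^{-1}$ for $a\in A^\times$. *)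

(* Defs.v *)
From HB Require Import structures.
From mathcomp Require Import all_boot all_order all_algebra.
From mathcomp Require Import boolp.
Set Implicit Arguments. Unset Strict Implicit. Unset Printing Implicit Defensive.
Import GRing.Theory.
Local Open Scope quotient_scope.
Local Open Scope ring_scope.

Notation bilin f := (bilinear_for *:%R *:%R f).

Section TensorDef.
Variables (k : fieldType) (V W : lmodType k).

(* The tensor product is the set of formal sums of pairs (v, w), modulo the
   congruence generated by the relations below. *)
Inductive tensor_rel : seq (V * W) -> seq (V * W) -> Prop :=
| TensorRefl s : tensor_rel s s
| TensorSym s t : tensor_rel s t -> tensor_rel t s
| TensorTrans s t u : tensor_rel s t -> tensor_rel t u -> tensor_rel s u
| TensorCat s s' t t' :
    tensor_rel s s' -> tensor_rel t t' -> tensor_rel (s ++ t) (s' ++ t')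
| TensorCatC s t : tensor_rel (s ++ t) (t ++ s)
| TensorZero w : tensor_rel [:: (0, w)] [::]
| TensorAddl v v' w : tensor_rel [:: (v + v', w)] [:: (v, w); (v', w)]
| TensorAddr v w w' : tensor_rel [:: (v, w + w')] [:: (v, w); (v, w')]
| TensorScale a v w : tensor_rel [:: (a *: v, w)] [:: (v, a *: w)].

Definition tensor_relb : rel (seq (V * W)) := fun s t => `[< tensor_rel s t >].

Lemma tensor_relb_refl : reflexive tensor_relb.
Proof. by move=> s; apply/asboolP; constructor. Qed.

Lemma tensor_relb_sym : symmetric tensor_relb.
Proof.
by move=> s t; apply/idP/idP => /asboolP st; apply/asboolP; apply: TensorSym.
Qed.

Lemma tensor_relb_trans : transitive tensor_relb.
Proof.
move=> t s u /asboolP st /asboolP tu; apply/asboolP; exact: TensorTrans tu.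
Qed.

Canonical tensor_equiv :=
  EquivRel tensor_relb tensor_relb_refl tensor_relb_sym tensor_relb_trans.

Record tensor := Tensor { tensor_val : {eq_quot tensor_relb} }.

Lemma tensor_valK : cancel tensor_val Tensor. Proof. by case. Qed.
HB.instance Definition _ := Choice.copy tensor (can_type tensor_valK).

Definition tclass (s : seq (V * W)) : tensor := Tensor (\pi s).

Lemma tensor_eqP (s t : seq (V * W)) : tclass s = tclass t <-> tensor_rel s t.
Proof.
split=> [[] /eqquotP/asboolP //|st]; congr Tensor; apply/eqquotP; exact/asboolP.
Qed.

Definition tens (v : V) (w : W) : tensor := tclass [:: (v, w)].

(* A representation of t as a finite sum of pure tensors, see [sum_terms]. *)
Definition terms (t : tensor) : seq (V * W) := repr (tensor_val t).

Lemma pi_terms t : tclass (terms t) = t.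
Proof. by case: t => x; rewrite /tclass /terms reprK. Qed.

Lemma termsK s : tensor_rel (terms (tclass s)) s.
Proof. by apply/tensor_eqP; rewrite pi_terms. Qed.

Definition tensor_add (x y : tensor) : tensor :=
  tclass (terms x ++ terms y).
Definition tensor_scale (a : k) (x : tensor) : tensor :=
  tclass [seq (a *: p.1, p.2) | p <- terms x].
Definition tensor_opp := tensor_scale (-1).
Definition tensor_zero : tensor := tclass [::].

Lemma scale_rel (a : k) s t : tensor_rel s t ->
  tensor_rel [seq (a *: p.1, p.2) | p <- s] [seq (a *: p.1, p.2) | p <- t].
Proof.
elim=> [||x y z _ h1 _ h2|x x' y y' _ h1 _ h2|x y|w|v v' w|v w w'|b v w] /=.
- by constructor.
- by move=> x y _; apply: TensorSym.
- exact: TensorTrans h2.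
- by rewrite !map_cat; apply: TensorCat.
- by rewrite !map_cat; apply: TensorCatC.
- by rewrite scaler0; apply: TensorZero.
- by rewrite scalerDr; apply: TensorAddl.
- exact: TensorAddr.
- rewrite scalerA mulrC -scalerA; exact: TensorScale.
Qed.

Lemma addE s t :
  tensor_add (tclass s) (tclass t) = tclass (s ++ t).
Proof. by apply/tensor_eqP/TensorCat; apply: termsK. Qed.

Lemma scaleE a s : tensor_scale a (tclass s) =
  tclass [seq (a *: p.1, p.2) | p <- s].
Proof. by apply/tensor_eqP/scale_rel/termsK. Qed.

Fact tensor_addA : associative tensor_add.
Proof.
by move=> x y z; rewrite -(pi_terms x) -(pi_terms y) -(pi_terms z) !addE catA.
Qed.
Fact tensor_addC : commutative tensor_add.
Proof.
move=> x y; rewrite -(pi_terms x) -(pi_terms y) !addE.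
exact/tensor_eqP/TensorCatC.
Qed.
Fact tensor_add0 : left_id tensor_zero tensor_add.
Proof. by move=> x; rewrite -(pi_terms x) addE. Qed.

Lemma scale_addl a b s : tclass [seq ((a + b) *: p.1, p.2) | p <- s] =
  tensor_add (tclass [seq (a *: p.1, p.2) | p <- s])
             (tclass [seq (b *: p.1, p.2) | p <- s]).
Proof.
elim: s => [|[v w] s IH] /=; first by rewrite tensor_add0.
rewrite -cat1s -addE IH -(cat1s (a *: v, w)) -(cat1s (b *: v, w)) -!addE.
rewrite scalerDl.
have -> : tclass [:: (a *: v + b *: v, w)] =
  tensor_add (tclass [:: (a *: v, w)]) (tclass [:: (b *: v, w)]).
  rewrite addE; exact/tensor_eqP/TensorAddl.
rewrite -!tensor_addA; congr tensor_add.
by rewrite !tensor_addA (tensor_addC (tclass [:: (b *: v, w)])).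
Qed.

Lemma scale_zero s : tclass [seq (0 *: p.1, p.2) | p <- s] = tensor_zero.
Proof.
elim: s => [|[v w] s IH] //=.
rewrite -cat1s -addE IH scale0r.
have -> : tclass [:: (0, w)] = tensor_zero by exact/tensor_eqP/TensorZero.
exact: tensor_add0.
Qed.

Fact tensor_addN : left_inverse tensor_zero tensor_opp tensor_add.
Proof.
move=> x; rewrite /tensor_opp -(pi_terms x) scaleE.
have -> : tclass (terms x) =
    tclass [seq (1 *: p.1, p.2) | p <- terms x].
  by congr (tclass _); rewrite -[LHS]map_id; apply: eq_map=> -[v w]/=; rewrite scale1r.
by rewrite -scale_addl addNr scale_zero.
Qed.

HB.instance Definition _ := GRing.isZmodule.Build tensor
  tensor_addA tensor_addC tensor_add0 tensor_addN.

Fact tensor_scaleA a b x :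
  tensor_scale a (tensor_scale b x) = tensor_scale (a * b) x.
Proof.
rewrite -(pi_terms x) !scaleE -map_comp; congr (tclass _).
by apply: eq_map => -[v w] /=; rewrite scalerA.
Qed.
Fact tensor_scale1 : left_id 1 tensor_scale.
Proof.
move=> x; rewrite -[RHS]pi_terms; congr (tclass _).
by rewrite -[RHS]map_id; apply: eq_map => -[v w] /=; rewrite scale1r.
Qed.
Fact tensor_scaleDr : right_distributive tensor_scale +%R.
Proof.
move=> a x y; rewrite -(pi_terms x) -(pi_terms y) /GRing.add /= addE !scaleE.
by rewrite addE map_cat.
Qed.
Fact tensor_scaleDl x : {morph tensor_scale^~ x : a b / a + b}.
Proof.
by move=> a b; rewrite -(pi_terms x) !scaleE scale_addl.
Qed.

HB.instance Definition _ := GRing.Zmodule_isLmodule.Build k tensor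
  tensor_scaleA tensor_scale1 tensor_scaleDr tensor_scaleDl.

End TensorDef.

Notation "V ⊗ W" := (tensor V W)
  (at level 40, left associativity) : type_scope.
Notation "V ⊗ W" := (tensor V W) : ring_scope.
Notation "v \ox w" := (tens v w)
  (at level 40, left associativity) : ring_scope.

Section TensorTheory.
Variables (k : fieldType).

Lemma tens_bilin (V W : lmodType k) : bilin (@tens k V W).
Proof.
have D v v' (w : W) : (v + v' : V) \ox w = v \ox w + v' \ox w.
  rewrite /tens {2}/GRing.add /= addE; exact/tensor_eqP/TensorAddl.
have Z a v (w : W) : (a *: v : V) \ox w = a *: (v \ox w).
  by rewrite /tens /GRing.scale /= scaleE.
have Dr v (w w' : W) : (v : V) \ox (w + w') = v \ox w + v \ox w'.
  rewrite /tens {2}/GRing.add /= addE; exact/tensor_eqP/TensorAddr.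
have Zr a v (w : W) : (v : V) \ox (a *: w) = a *: (v \ox w).
  rewrite -Z; apply/esym/tensor_eqP/TensorScale.
split=> [w|v] a x y /=; first by rewrite D Z.
by rewrite Dr Zr.
Qed.

Lemma sum_terms (V W : lmodType k) (t : V ⊗ W) :
  \sum_(p <- terms t) p.1 \ox p.2 = t.
Proof.
rewrite -[RHS]pi_terms; elim: (terms t) => [|[v w] s IH] /=.
  by rewrite big_nil.
by rewrite big_cons IH -cat1s -addE.
Qed.


Lemma sum_tensor_rel (V W U : lmodType k) (f : V -> W -> U) (bf : bilin f) s t :
  tensor_rel s t -> \sum_(p <- s) f p.1 p.2 = \sum_(p <- t) f p.1 p.2.
Proof.
have Dl w v v' : f (v + v') w = f v w + f v' w.
  by have := bf.1 w 1 v v'; rewrite /= !scale1r.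
have Dr v w w' : f v (w + w') = f v w + f v w'.
  by have := bf.2 v 1 w w'; rewrite /= !scale1r.
have f0 w : f 0 w = 0 by apply: (addrI (f 0 w)); rewrite -Dl !addr0.
have f0r v : f v 0 = 0 by apply: (addrI (f v 0)); rewrite -Dr !addr0.
elim=> {s t} [||x y z _ -> _ -> //|x x' y y' _ h1 _ h2|x y|w|v v' w|v w w'|b v w] //=.
- by rewrite !big_cat /= h1 h2.
- by rewrite !big_cat /= addrC.
- by rewrite big_cons big_nil f0 addr0.
- by rewrite !big_cons big_nil !addr0 Dl.
- by rewrite !big_cons big_nil !addr0 Dr.
- rewrite !big_cons big_nil !addr0 /=.
  have /= := bf.1 w b v 0; have /= := bf.2 v b w 0.
  by rewrite f0 f0r !addr0 => -> ->.
Qed.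

Lemma sum_tens (V W U : lmodType k) (f : V -> W -> U) (bf : bilin f) v w :
  \sum_(p <- terms (v \ox w)) f p.1 p.2 = f v w.
Proof.
by rewrite (sum_tensor_rel bf (termsK _)) big_cons big_nil addr0.
Qed.

Lemma sum_terms_linear (V W U : lmodType k) (f : V -> W -> U) (bf : bilin f) :
  linear (fun t : V ⊗ W => \sum_(p <- terms t) f p.1 p.2).
Proof.
move=> a x y.
have rel : tensor_rel (terms (a *: x + y))
    ([seq (a *: p.1, p.2) | p <- terms x] ++ terms y).
  apply: TensorTrans (termsK _) _; apply: TensorCat; last by constructor.
  by rewrite /GRing.scale /= /tensor_scale; apply: termsK.
rewrite (sum_tensor_rel bf rel) big_cat /= big_map scaler_sumr; congr (_ + _).
apply: eq_bigr => -[v w] _ /=.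
have := bf.1 w a v 0 => /=; rewrite !addr0 => ->.
have f0 : f 0 w = 0.
  by have := bf.1 w 1 0 0; rewrite /= !scale1r !addr0 => /esym/(canRL (addrK _)); rewrite subrr.
by rewrite f0 addr0.
Qed.

End TensorTheory.

Section LinearClosure.
Variables (k : fieldType).
Implicit Types U V W X : lmodType k.

Definition mk_linear U V (f : U -> V) (lf : linear f) : {linear U -> V} :=
  HB.pack f (GRing.isLinear.Build k U V _ f lf).

Lemma lin_id V : linear (fun x : V => x). Proof. by []. Qed.

Lemma lin_app U V W (g : {linear V -> W}) (f : U -> V) :
  linear f -> linear (fun x => g (f x)).
Proof. by move=> lf a x y; rewrite lf linearP. Qed.

Lemma lin_sum U V I (s : seq I) (F : I -> U -> V) :
  (forall i, linear (F i)) -> linear (fun x => \sum_(i <- s) F i x).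
Proof.
move=> lF a x y; rewrite scaler_sumr -big_split; apply: eq_bigr => i _.
exact: lF.
Qed.

Lemma lin_bil U V W X (B : V -> W -> X) (w : W) (f : U -> V) :
  bilin B -> linear f -> linear (fun x => B (f x) w).
Proof. by move=> bB lf a x y; rewrite lf (bB.1 w). Qed.

Lemma lin_bir U V W X (B : V -> W -> X) (v : V) (f : U -> W) :
  bilin B -> linear f -> linear (fun x => B v (f x)).
Proof. by move=> bB lf a x y; rewrite lf (bB.2 v). Qed.

Lemma lin_tensl U V W (w : W) (f : U -> V) :
  linear f -> linear (fun x => f x \ox w).
Proof. exact/lin_bil/tens_bilin. Qed.

Lemma lin_tensr U V W (v : V) (f : U -> W) :
  linear f -> linear (fun x => v \ox f x).
Proof. exact/lin_bir/tens_bilin. Qed.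

Lemma lin_scalel U V (v : V) (f : U -> k^o) :
  linear f -> linear (fun x => f x *: v).
Proof. by move=> lf a x y; rewrite lf scalerDl scalerA. Qed.

Lemma lin_scaler U V (c : k) (f : U -> V) :
  linear f -> linear (fun x => c *: f x).
Proof. by move=> lf a x y; rewrite lf scalerDr !scalerA mulrC. Qed.

Lemma lin_terms U V W X (F : V * W -> X) (g : U -> V ⊗ W) :
  bilin (fun v w => F (v, w)) -> linear g ->
  linear (fun x => \sum_(p <- terms (g x)) F p).
Proof.
move=> bF lg a x y.
have E t : \sum_(p <- terms t) F p = \sum_(p <- terms t) F (p.1, p.2).
  by apply: eq_bigr => -[].
by rewrite !E lg (sum_terms_linear bF).
Qed.

Lemma sum_tensE V W X (F : V * W -> X) v w :
  bilin (fun v w => F (v, w)) -> \sum_(p <- terms (v \ox w)) F p = F (v, w).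
Proof.
move=> bF; rewrite -(sum_tens bF); apply: eq_bigr => -[] //.
Qed.

Lemma tens_ext V W X (f g : V ⊗ W -> X) : linear f -> linear g ->
  (forall v w, f (v \ox w) = g (v \ox w)) -> f =1 g.
Proof.
move=> lf lg fg t.
pose f' : {linear V ⊗ W -> X} := mk_linear lf.
pose g' : {linear V ⊗ W -> X} := mk_linear lg.
rewrite -[f]/(f' : _ -> _) -[g]/(g' : _ -> _) -(sum_terms t) !linear_sum.
by apply: eq_bigr => p _; apply: fg.
Qed.

Lemma sum_terms_sum V W X I (s : seq I) (G : I -> V ⊗ W) (F : V * W -> X) :
  bilin (fun v w => F (v, w)) ->
  \sum_(p <- terms (\sum_(i <- s) G i)) F p =
  \sum_(i <- s) \sum_(p <- terms (G i)) F p.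
Proof.
move=> bF.
pose f t := \sum_(p <- terms t) F p.
have lf : linear f by apply: lin_terms bF _.
pose f' : {linear V ⊗ W -> X} := mk_linear lf.
by rewrite -[LHS]/(f' _) linear_sum.
Qed.

End LinearClosure.

Ltac lin := repeat first
  [ progress intros
  | match goal with |- bilinear_for _ _ _ => split end
  | match goal with h : _ |- _ => solve [apply: h] end
  | exact: lin_id | apply: lin_tensl | apply: lin_tensr
  | apply: lin_sum | apply: lin_terms | apply: lin_scalel | apply: lin_scaler
  | progress simpl | apply: lin_app ].

(* Sweedler notation: c_(1) and c_(2) are the components p.1 and p.2 of the
   terms p of a representation of the coproduct of c.  The choice of the
   representation is irrelevant when the summand is bilinear in (p.1, p.2), see
   [sum_tensE]. *)
HB.mixin Record isCoalgebra (k : fieldType) C of GRing.Lmodule k C := {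
  coprod : {linear C -> C ⊗ C};
  counit : {linear C -> k^o};
  coprodA : forall c : C,
    \sum_(p <- terms (coprod c)) \sum_(q <- terms (coprod p.1))
      q.1 \ox (q.2 \ox p.2) =
    \sum_(p <- terms (coprod c)) \sum_(q <- terms (coprod p.2))
      p.1 \ox (q.1 \ox q.2);
  counitl : forall c : C, \sum_(p <- terms (coprod c)) counit p.1 *: p.2 = c;
  counitr : forall c : C, \sum_(p <- terms (coprod c)) counit p.2 *: p.1 = c
}.

#[short(type="coalgType")]
HB.structure Definition Coalgebra (k : fieldType) :=
  {C of GRing.Lmodule k C & isCoalgebra k C}.

HB.mixin Record Coalgebra_isCocommutative (k : fieldType) C
    of Coalgebra k C := {
  coprodC : forall c : C,
    \sum_(p <- terms (coprod c)) p.2 \ox p.1 = coprod c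
}.

#[short(type="cocomCoalgType")]
HB.structure Definition CocomCoalgebra (k : fieldType) :=
  {C of Coalgebra k C & Coalgebra_isCocommutative k C}.

HB.mixin Record Coalgebra_isBialgebra (k : fieldType) H
    of GRing.Algebra k H & Coalgebra k H := {
  coprodM : forall x y : H, coprod (x * y) =
    \sum_(p <- terms (coprod x)) \sum_(q <- terms (coprod y))
      (p.1 * q.1) \ox (p.2 * q.2);
  coprod1 : coprod (1 : H) = 1 \ox 1;
  counitM : forall x y : H, counit (x * y) = counit x * counit y;
  counit1 : counit (1 : H) = 1
}.

#[short(type="bialgType")]
HB.structure Definition Bialgebra (k : fieldType) :=
  {H of GRing.Algebra k H & Coalgebra k H & Coalgebra_isBialgebra k H}.

HB.mixin Record Bialgebra_isHopf (k : fieldType) H of Bialgebra k H := {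
  antipode : {linear H -> H};
  antipodel : forall h : H,
    \sum_(p <- terms (coprod h)) antipode p.1 * p.2 = counit h *: 1;
  antipoder : forall h : H,
    \sum_(p <- terms (coprod h)) p.1 * antipode p.2 = counit h *: 1
}.

#[short(type="hopfType")]
HB.structure Definition Hopf (k : fieldType) :=
  {H of Bialgebra k H & Bialgebra_isHopf k H}.

#[short(type="cocomHopfType")]
HB.structure Definition CocomHopf (k : fieldType) :=
  {H of Hopf k H & Coalgebra_isCocommutative k H}.

Section CoalgTheory.
Variables (k : fieldType) (C : coalgType k) (X : lmodType k).

Lemma coassocE (G : C -> C -> C -> X) :
  (forall x y, linear (G x y)) -> (forall x z, linear (fun y => G x y z)) ->
  (forall y z, linear (fun x => G x y z)) -> forall c,
  \sum_(p <- terms (coprod c)) \sum_(q <- terms (coprod p.1)) G q.1 q.2 p.2 =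
  \sum_(p <- terms (coprod c)) \sum_(q <- terms (coprod p.2)) G p.1 q.1 q.2.
Proof.
move=> l3 l2 l1 c.
pose F (u : C ⊗ (C ⊗ C)) : X :=
  \sum_(p <- terms u) \sum_(q <- terms p.2) G p.1 q.1 q.2.
have lF : linear F.
  by rewrite /F; lin.
pose F' : {linear C ⊗ (C ⊗ C) -> X} := mk_linear lF.
have FE x y z : F (x \ox (y \ox z)) = G x y z.
  rewrite /F sum_tensE /=; first by rewrite sum_tensE //; lin.
  by lin.
have := congr1 F' (coprodA c); rewrite !linear_sum.
under eq_bigr do rewrite linear_sum.
under [in X in _ = X -> _]eq_bigr do rewrite linear_sum.
rewrite -[F' : _ -> _]/F.
under eq_bigr do under eq_bigr do rewrite FE.
by under [in X in _ = X -> _]eq_bigr do under eq_bigr do rewrite FE.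
Qed.

Lemma counitlE (G : {linear C -> X}) c :
  \sum_(p <- terms (coprod c)) counit p.1 *: G p.2 = G c.
Proof.
rewrite -[in RHS](counitl c) linear_sum.
by apply: eq_bigr => p _; rewrite linearZ.
Qed.

Lemma counitrE (G : {linear C -> X}) c :
  \sum_(p <- terms (coprod c)) counit p.2 *: G p.1 = G c.
Proof.
rewrite -[in RHS](counitr c) linear_sum.
by apply: eq_bigr => p _; rewrite linearZ.
Qed.

End CoalgTheory.

Lemma cocomE (k : fieldType) (C : cocomCoalgType k) (X : lmodType k)
    (F : C -> C -> X) : bilin F -> forall c,
  \sum_(p <- terms (coprod c)) F p.2 p.1 = \sum_(p <- terms (coprod c)) F p.1 p.2.
Proof.
move=> bF c; rewrite -[in RHS](coprodC c) sum_terms_sum //.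
by apply: eq_bigr => p _; rewrite sum_tensE.
Qed.

Section BaseCoalg.
Variables (k : fieldType).

Definition base_coprod (a : k^o) : k^o ⊗ k^o :=
  (a : k) *: ((1 : k^o) \ox (1 : k^o)).
Fact base_coprod_linear : linear base_coprod.
Proof. by move=> a x y; rewrite /base_coprod scalerDl scalerA. Qed.
HB.instance Definition _ := GRing.isLinear.Build k k^o (k^o ⊗ k^o) _
  base_coprod base_coprod_linear.

Lemma sum_base_coprod (X : lmodType k) (F : k^o * k^o -> X) (a : k) :
  bilin (fun v w => F (v, w)) ->
  \sum_(p <- terms (base_coprod a)) F p = a *: F (1, 1).
Proof.
move=> bF.
have lF : linear (fun t : k^o ⊗ k^o => \sum_(p <- terms t) F p).
  by apply: lin_terms.
rewrite -[LHS]/(mk_linear lF _) linearZ /=.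
by rewrite sum_tensE.
Qed.

Fact base_coprodA (c : k^o) :
    \sum_(p <- terms (base_coprod c)) \sum_(q <- terms (base_coprod p.1))
      q.1 \ox (q.2 \ox p.2) =
    \sum_(p <- terms (base_coprod c)) \sum_(q <- terms (base_coprod p.2))
      p.1 \ox (q.1 \ox q.2).
Proof.
have l := base_coprod_linear.
rewrite sum_base_coprod /=; last by lin.
rewrite [RHS]sum_base_coprod /=; last by lin.
rewrite sum_base_coprod /=; last by lin.
by rewrite sum_base_coprod //=; lin.
Qed.
Fact base_counitl (c : k^o) :
  \sum_(p <- terms (base_coprod c)) (p.1 : k) *: p.2 = c.
Proof.
rewrite sum_base_coprod /= ?scale1r; first exact: mulr1.
split=> [w|v] a x y /=; first by rewrite scalerDl scalerA.
by rewrite scalerDr !scalerA mulrC.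
Qed.
Fact base_counitr (c : k^o) :
  \sum_(p <- terms (base_coprod c)) (p.2 : k) *: p.1 = c.
Proof.
rewrite sum_base_coprod /= ?scale1r; first exact: mulr1.
split=> [v|w] a x y /=; last by rewrite scalerDl scalerA.
by rewrite scalerDr !scalerA mulrC.
Qed.
Fact base_coprodC (c : k^o) :
  \sum_(p <- terms (base_coprod c)) p.2 \ox p.1 = base_coprod c.
Proof. by rewrite sum_base_coprod //=; lin. Qed.

HB.instance Definition _ := @isCoalgebra.Build k k^o
  base_coprod idfun base_coprodA base_counitl base_counitr.
HB.instance Definition _ := Coalgebra_isCocommutative.Build k k^o base_coprodC.

End BaseCoalg.

Section TensorCoalg.
Variables (k : fieldType).

Section Coalg.
Variables (C D : coalgType k).

Definition tensor_coprod (t : C ⊗ D) : (C ⊗ D) ⊗ (C ⊗ D) :=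
  \sum_(x <- terms t)
    \sum_(p <- terms (coprod x.1)) \sum_(q <- terms (coprod x.2))
      (p.1 \ox q.1) \ox (p.2 \ox q.2).

Definition tensor_counit (t : C ⊗ D) : k^o :=
  \sum_(x <- terms t) counit x.1 * counit x.2.

Fact tensor_coprod_linear : linear tensor_coprod.
Proof. by rewrite /tensor_coprod; lin. Qed.
HB.instance Definition _ := GRing.isLinear.Build k (C ⊗ D) _ _
  tensor_coprod tensor_coprod_linear.

Fact counit_mul_bilin :
  bilin (fun (c : C) (d : D) => counit c * counit d : k^o).
Proof.
split=> [d|c] a x y /=; first by rewrite linearP mulrDl scalerAl.
by rewrite linearP mulrDr scalerAr.
Qed.

Fact tensor_counit_linear : linear tensor_counit.
Proof. by apply: lin_terms; [exact: counit_mul_bilin | exact: lin_id]. Qed.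
HB.instance Definition _ := GRing.isLinear.Build k (C ⊗ D) _ _
  tensor_counit tensor_counit_linear.

Lemma tensor_coprodE c d : tensor_coprod (c \ox d) =
  \sum_(p <- terms (coprod c)) \sum_(q <- terms (coprod d))
      (p.1 \ox q.1) \ox (p.2 \ox q.2).
Proof. by rewrite /tensor_coprod sum_tensE //; lin. Qed.

Lemma tensor_counitE c d : tensor_counit (c \ox d) = counit c * counit d.
Proof. by rewrite /tensor_counit sum_tensE //; exact: counit_mul_bilin. Qed.

Lemma sum_tensor_coprod (X : lmodType k)
    (F : (C ⊗ D) * (C ⊗ D) -> X) c d :
  bilin (fun v w => F (v, w)) ->
  \sum_(z <- terms (tensor_coprod (c \ox d))) F z =
  \sum_(p <- terms (coprod c)) \sum_(q <- terms (coprod d))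
    F (p.1 \ox q.1, p.2 \ox q.2).
Proof.
move=> bF; rewrite tensor_coprodE sum_terms_sum //; apply: eq_bigr => p _.
by rewrite sum_terms_sum //; apply: eq_bigr => q _; rewrite sum_tensE.
Qed.

Fact tensor_coprodA (t : C ⊗ D) :
    \sum_(p <- terms (tensor_coprod t)) \sum_(q <- terms (tensor_coprod p.1))
      q.1 \ox (q.2 \ox p.2) =
    \sum_(p <- terms (tensor_coprod t)) \sum_(q <- terms (tensor_coprod p.2))
      p.1 \ox (q.1 \ox q.2).
Proof.
have l := tensor_coprod_linear.
move: t; apply: tens_ext; [by lin|by lin|] => c d /=.
rewrite sum_tensor_coprod /=; last by lin.
rewrite [RHS]sum_tensor_coprod /=; last by lin.
transitivity (\sum_(p <- terms (coprod c)) \sum_(p' <- terms (coprod p.1))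
  \sum_(q <- terms (coprod d)) \sum_(q' <- terms (coprod q.1))
    (p'.1 \ox q'.1) \ox ((p'.2 \ox q'.2) \ox (p.2 \ox q.2))).
  apply: eq_bigr => p _; rewrite exchange_big; apply: eq_bigr => q _.
  by rewrite sum_tensor_coprod //; lin.
transitivity (\sum_(p <- terms (coprod c)) \sum_(p' <- terms (coprod p.2))
  \sum_(q <- terms (coprod d)) \sum_(q' <- terms (coprod q.2))
    (p.1 \ox q.1) \ox ((p'.1 \ox q'.1) \ox (p'.2 \ox q'.2))); last first.
  apply: eq_bigr => p _; rewrite exchange_big; apply: eq_bigr => q _.
  by rewrite sum_tensor_coprod //; lin.
rewrite (@coassocE k C _ (fun x y z => \sum_(j <- terms (coprod d))
  \sum_(i0 <- terms (coprod j.1)) (x \ox i0.1) \ox ((y \ox i0.2) \ox (z \ox j.2))));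
  try by lin.
apply: eq_bigr => p _; apply: eq_bigr => q _.
by rewrite (@coassocE k D _ (fun x y z => (p.1 \ox x) \ox ((q.1 \ox y) \ox (q.2 \ox z))));
  try by lin.
Qed.

Fact tensor_counitl (t : C ⊗ D) :
  \sum_(p <- terms (tensor_coprod t)) tensor_counit p.1 *: p.2 = t.
Proof.
have l := tensor_coprod_linear; have l' := tensor_counit_linear.
move: t; apply: tens_ext; [by lin|by lin|] => c d /=.
rewrite sum_tensor_coprod /=; last by lin.
under eq_bigr => p _ do under eq_bigr => q _ do rewrite tensor_counitE -scalerA.
under eq_bigr => p _ do rewrite -scaler_sumr.
have lr (x : C) : linear (fun y : D => x \ox y) by lin.
under eq_bigr => p _ do rewrite (counitlE (mk_linear (lr p.2))) /=.
have ll : linear (fun x : C => x \ox d) by lin.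
by rewrite (counitlE (mk_linear ll)).
Qed.

Fact tensor_counitr (t : C ⊗ D) :
  \sum_(p <- terms (tensor_coprod t)) tensor_counit p.2 *: p.1 = t.
Proof.
have l := tensor_coprod_linear; have l' := tensor_counit_linear.
move: t; apply: tens_ext; [by lin|by lin|] => c d /=.
rewrite sum_tensor_coprod /=; last by lin.
under eq_bigr => p _ do under eq_bigr => q _ do rewrite tensor_counitE -scalerA.
under eq_bigr => p _ do rewrite -scaler_sumr.
have lr (x : C) : linear (fun y : D => x \ox y) by lin.
under eq_bigr => p _ do rewrite (counitrE (mk_linear (lr p.1))) /=.
have ll : linear (fun x : C => x \ox d) by lin.
by rewrite (counitrE (mk_linear ll)).
Qed.

HB.instance Definition _ := @isCoalgebra.Build k (C ⊗ D)
  tensor_coprod tensor_counit tensor_coprodA tensor_counitl tensor_counitr.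

End Coalg.

Variables (C D : cocomCoalgType k).

Fact tensor_coprodC (t : C ⊗ D) :
  \sum_(p <- terms (coprod t)) p.2 \ox p.1 = coprod t.
Proof.
have l := @tensor_coprod_linear C D.
move: t; apply: tens_ext; [by lin|by lin|] => c d /=.
rewrite /coprod /= sum_tensor_coprod ?tensor_coprodE /=; last by lin.
pose G x y := \sum_(q <- terms (coprod d)) (x \ox q.1) \ox (y \ox q.2) : tensor (C ⊗ D) (C ⊗ D).
rewrite -(@cocomE k C _ G) /G; last by lin.
apply: eq_bigr => p _.
by rewrite (@cocomE k D _ (fun x y => (p.2 \ox x) \ox (p.1 \ox y))) //; lin.
Qed.

HB.instance Definition _ :=
  Coalgebra_isCocommutative.Build k (C ⊗ D) tensor_coprodC.

End TensorCoalg.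

Lemma alg_mul_bilin (k : fieldType) (H : algType k) :
  bilin (fun u v : H => u * v).
Proof.
split=> [w|v] a x y /=; first by rewrite mulrDl scalerAl.
by rewrite mulrDr scalerAr.
Qed.

Lemma lin_algmull (k : fieldType) (H : algType k) (U : lmodType k) (w : H)
    (f : U -> H) : linear f -> linear (fun x => f x * w).
Proof. exact: lin_bil (alg_mul_bilin H). Qed.

Lemma lin_algmulr (k : fieldType) (H : algType k) (U : lmodType k) (v : H)
    (f : U -> H) : linear f -> linear (fun x => v * f x).
Proof. exact: lin_bir (alg_mul_bilin H). Qed.

Ltac lina := repeat first
  [ progress intros
  | match goal with |- bilinear_for _ _ _ => split end
  | match goal with h : _ |- _ => solve [apply: h] end
  | exact: lin_id | apply: lin_tensl | apply: lin_tensr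
  | apply: lin_algmull | apply: lin_algmulr
  | apply: lin_sum | apply: lin_terms | apply: lin_scalel | apply: lin_scaler
  | progress simpl | apply: lin_app ].

(* Hom_k(C, A) with the convolution product. *)
Definition conv_hom (k : fieldType) (C : coalgType k) (A : comAlgType k) :=
  {linear C -> A}.
HB.instance Definition _ (k : fieldType) (C : coalgType k)
  (A : comAlgType k) := gen_eqMixin (conv_hom C A).
HB.instance Definition _ (k : fieldType) (C : coalgType k)
  (A : comAlgType k) := gen_choiceMixin (conv_hom C A).

Section Convolution.
Variables (k : fieldType) (C : coalgType k) (A : comAlgType k).
Local Notation Hom := (conv_hom C A).
Implicit Types f g h : Hom.

Lemma conv_homP f g : (forall c, f c = g c) -> f = g.
Proof.
case: f g => [f [[f0] [f1]]] [g [[g0] [g1]]] /= /funext fg.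
subst g; congr (GRing.Linear.Pack (GRing.Linear.Class _ _));
  by congr (_ _); apply: Prop_irrelevance.
Qed.

Definition conv_mul_fun f g (c : C) : A :=
  \sum_(p <- terms (coprod c)) f p.1 * g p.2.
Definition conv_one_fun (c : C) : A := counit c *: 1.
Definition conv_add_fun f g (c : C) : A := f c + g c.
Definition conv_opp_fun f (c : C) : A := - f c.
Definition conv_zero_fun (c : C) : A := 0.

Fact conv_mul_linear f g : linear (conv_mul_fun f g).
Proof. by rewrite /conv_mul_fun; lina. Qed.
Fact conv_one_linear : linear conv_one_fun.
Proof. by rewrite /conv_one_fun; lina. Qed.
Fact conv_add_linear f g : linear (conv_add_fun f g).
Proof.
by move=> a x y; rewrite /conv_add_fun !linearP scalerDr addrACA.
Qed.
Fact conv_opp_linear f : linear (conv_opp_fun f).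
Proof. by move=> a x y; rewrite /conv_opp_fun linearP opprD scalerN. Qed.
Fact conv_zero_linear : linear conv_zero_fun.
Proof. by move=> a x y; rewrite /conv_zero_fun scaler0 addr0. Qed.

Definition conv_mul f g : Hom := mk_linear (conv_mul_linear f g).
Definition conv_one : Hom := mk_linear conv_one_linear.
Definition conv_add f g : Hom := mk_linear (conv_add_linear f g).
Definition conv_opp f : Hom := mk_linear (conv_opp_linear f).
Definition conv_zero : Hom := mk_linear conv_zero_linear.

Fact conv_addA : associative conv_add.
Proof. by move=> f g h; apply: conv_homP => c; apply: addrA. Qed.
Fact conv_addC : commutative conv_add.
Proof. by move=> f g; apply: conv_homP => c; apply: addrC. Qed.
Fact conv_add0 : left_id conv_zero conv_add.
Proof. by move=> f; apply: conv_homP => c; apply: add0r. Qed.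
Fact conv_addN : left_inverse conv_zero conv_opp conv_add.
Proof. by move=> f; apply: conv_homP => c; apply: addNr. Qed.
HB.instance Definition _ := GRing.isZmodule.Build Hom
  conv_addA conv_addC conv_add0 conv_addN.

Fact conv_mulA : associative conv_mul.
Proof.
move=> f g h; apply: conv_homP => c; rewrite /= /conv_mul_fun /= /conv_mul_fun.
transitivity (\sum_(p <- terms (coprod c)) \sum_(q <- terms (coprod p.2))
  f p.1 * (g q.1 * h q.2)).
  by apply: eq_bigr => p _; rewrite mulr_sumr.
rewrite -(@coassocE k C _ (fun x y z => f x * (g y * h z))); try by lina.
by apply: eq_bigr => p _; rewrite mulr_suml; apply: eq_bigr => q _; rewrite mulrA.
Qed.
Fact conv_mul1 : left_id conv_one conv_mul.
Proof.
move=> f; apply: conv_homP => c; rewrite /= /conv_mul_fun -[RHS]counitlE.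
by apply: eq_bigr => p _; rewrite /= /conv_one_fun -scalerAl mul1r.
Qed.
Fact conv_mulr1 : right_id conv_one conv_mul.
Proof.
move=> f; apply: conv_homP => c; rewrite /= /conv_mul_fun -[RHS]counitrE.
by apply: eq_bigr => p _; rewrite /= /conv_one_fun -scalerAr mulr1.
Qed.
Fact conv_mulDl : left_distributive conv_mul +%R.
Proof.
move=> f g h; apply: conv_homP => c; rewrite /= /conv_mul_fun /=.
rewrite /conv_add_fun /= /conv_mul_fun -big_split.
by apply: eq_bigr => p _; rewrite mulrDl.
Qed.
Fact conv_mulDr : right_distributive conv_mul +%R.
Proof.
move=> f g h; apply: conv_homP => c; rewrite /= /conv_mul_fun /=.
rewrite /conv_add_fun /= /conv_mul_fun -big_split.
by apply: eq_bigr => p _; rewrite mulrDr.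
Qed.
HB.instance Definition _ := GRing.Zmodule_isPzRing.Build Hom
  conv_mulA conv_mul1 conv_mulr1 conv_mulDl conv_mulDr.

Lemma conv_mulE f g c :
  (f * g) c = \sum_(p <- terms (coprod c)) f p.1 * g p.2.
Proof. by []. Qed.

Lemma conv_oneE c : (1 : Hom) c = counit c *: 1.
Proof. by []. Qed.

End Convolution.

Section ConvolutionCom.
Variables (k : fieldType) (C : cocomCoalgType k) (A : comAlgType k).

Fact conv_mulC : commutative ( *%R : conv_hom C A -> _ -> _).
Proof.
move=> f g; apply: conv_homP => c; rewrite !conv_mulE.
rewrite -(@cocomE k C _ (fun x y => f x * g y)); last by lina.
by apply: eq_bigr => p _; rewrite mulrC.
Qed.
HB.instance Definition _ :=
  GRing.PzRing_hasCommutativeMul.Build (conv_hom C A) conv_mulC.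

End ConvolutionCom.

Section LinearMaps.
Variables (k : fieldType).

Lemma tensZl (V W : lmodType k) a (v : V) (w : W) :
  (a *: v) \ox w = a *: (v \ox w).
Proof.
by rewrite -[LHS]/(mk_linear (lin_tensl w (@lin_id _ V)) _) linearZ.
Qed.

Lemma tensZr (V W : lmodType k) a (v : V) (w : W) :
  v \ox (a *: w) = a *: (v \ox w).
Proof.
by rewrite -[LHS]/(mk_linear (lin_tensr v (@lin_id _ W)) _) linearZ.
Qed.

Definition tmap (V V' W W' : lmodType k) (f : {linear V -> V'})
    (g : {linear W -> W'}) (t : V ⊗ W) : V' ⊗ W' :=
  \sum_(p <- terms t) f p.1 \ox g p.2.
Fact tmap_linear (V V' W W' : lmodType k) f g : linear (@tmap V V' W W' f g).
Proof. by rewrite /tmap; lina. Qed.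
HB.instance Definition _ (V V' W W' : lmodType k) f g := GRing.isLinear.Build k (V ⊗ W)
  (V' ⊗ W') _ (@tmap V V' W W' f g) (@tmap_linear V V' W W' f g).
Lemma tmapE (V V' W W' : lmodType k) f g v w :
  @tmap V V' W W' f g (v \ox w) = f v \ox g w.
Proof. by rewrite /tmap sum_tensE //; lina. Qed.

Definition mulT (H : algType k) (t : H ⊗ H) : H :=
  \sum_(p <- terms t) p.1 * p.2.
Fact mulT_linear (H : algType k) : linear (@mulT H).
Proof. by rewrite /mulT; lina. Qed.
HB.instance Definition _ (H : algType k) := GRing.isLinear.Build k (H ⊗ H) H _
  (@mulT H) (@mulT_linear H).
Lemma mulTE (H : algType k) (x y : H) : mulT (x \ox y) = x * y.
Proof. by rewrite /mulT sum_tensE //; lina. Qed.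

(* x ⊗ (y ⊗ t) |-> xy ⊗ t *)
Definition mul_first (H : algType k) (V : lmodType k) (t : H ⊗ (H ⊗ V)) :
    H ⊗ V :=
  \sum_(p <- terms t) \sum_(q <- terms p.2) (p.1 * q.1) \ox q.2.
Fact mul_first_linear (H : algType k) (V : lmodType k) : linear (@mul_first H V).
Proof. by rewrite /mul_first; lina. Qed.
HB.instance Definition _ (H : algType k) (V : lmodType k) :=
  GRing.isLinear.Build k (H ⊗ (H ⊗ V))
  (H ⊗ V) _ (@mul_first H V) (@mul_first_linear H V).
Lemma mul_firstE (H : algType k) (V : lmodType k) (x y : H) (t : V) :
  mul_first (x \ox (y \ox t)) = (x * y) \ox t.
Proof.
rewrite /mul_first sum_tensE /=; last by lina.
by rewrite sum_tensE //; lina.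
Qed.

Definition counit_one (C : coalgType k) (H : algType k) (c : C) : H :=
  counit c *: 1.
Fact counit_one_linear (C : coalgType k) (H : algType k) : linear (@counit_one C H).
Proof. by rewrite /counit_one; lina. Qed.
HB.instance Definition _ (C : coalgType k) (H : algType k) :=
  GRing.isLinear.Build k C H _
  (@counit_one C H) (@counit_one_linear C H).

Definition coalg_map (C D : coalgType k) (f : {linear C -> D}) : Prop :=
  forall c, coprod (f c) = \sum_(p <- terms (coprod c)) f p.1 \ox f p.2.

Lemma id_coalg_map (C : coalgType k) : coalg_map (idfun : {linear C -> C}).
Proof. by move=> c /=; rewrite sum_terms. Qed.

Lemma comp_coalg_map (C D E : coalgType k) (f : {linear C -> D})
    (g : {linear D -> E}) :
  coalg_map f -> coalg_map g -> coalg_map (g \o f : {linear C -> E}).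
Proof.
move=> cf cg c; rewrite /= cg cf sum_terms_sum; last by lina.
by apply: eq_bigr => p _; rewrite sum_tensE //; lina.
Qed.

Definition precomp (C D : coalgType k) (A : comAlgType k) (f : conv_hom D A)
  (phi : {linear C -> D}) : conv_hom C A := (f : {linear D -> A}) \o phi.

Lemma tmap_coalg_map (C C' D D' : coalgType k) (f : {linear C -> C'})
    (g : {linear D -> D'}) :
  coalg_map f -> coalg_map g ->
  coalg_map (tmap f g : {linear C ⊗ D -> C' ⊗ D'}).
Proof.
move=> cf cg; apply: tens_ext; [by move=> a x y; rewrite !linearP|by lina|] => c d /=.
rewrite tmapE /coprod /= tensor_coprodE sum_tensor_coprod /=; last by lina.
rewrite cf sum_terms_sum /=; last by lina.
apply: eq_bigr => p _; rewrite sum_tensE /=; last by lina.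
rewrite cg sum_terms_sum /=; last by lina.
by apply: eq_bigr => q _; rewrite sum_tensE /= ?tmapE //; lina.
Qed.

Lemma mulT_coalg_map (H : bialgType k) :
  coalg_map (@mulT H : {linear H ⊗ H -> H}).
Proof.
apply: tens_ext; [by move=> a x y; rewrite !linearP|by lina|] => x y /=.
rewrite mulTE coprodM /coprod /= sum_tensor_coprod /=; last by lina.
by apply: eq_bigr => p _; apply: eq_bigr => q _; rewrite !mulTE.
Qed.

Lemma counit_one_coalg_map (C : coalgType k) (H : bialgType k) :
  coalg_map (@counit_one C H : {linear C -> H}).
Proof.
move=> c; rewrite /= /counit_one linearZ /= coprod1.
have l : linear (fun x : C => (counit x : k) *: ((1 : H) \ox (1 : H))).
  by move=> a x y; rewrite linearP scalerDl scalerA.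
rewrite -[LHS]/(mk_linear l c) -(counitlE (mk_linear l)) /=.
by apply: eq_bigr => p _; rewrite tensZl tensZr.
Qed.

End LinearMaps.

Record partial_action (k : fieldType) (H : bialgType k) (A : comAlgType k) :=
  PartialAction {
    pact :> {linear H ⊗ A -> A};
    pact1 : forall a : A, pact (1 \ox a) = a;
    pactM : forall (h : H) (a b : A), pact (h \ox (a * b)) =
      \sum_(p <- terms (coprod h)) pact (p.1 \ox a) * pact (p.2 \ox b);
    pactA : forall (h l : H) (a : A), pact (h \ox pact (l \ox a)) =
      \sum_(p <- terms (coprod h))
        pact (p.1 \ox 1) * pact ((p.2 * l) \ox a)
  }.

(* H ⊗ (H ⊗ ... (H ⊗ k)), with n factors H. *)
Fixpoint tpow (k : fieldType) (H : cocomHopfType k) (n : nat) :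
    cocomCoalgType k :=
  if n is m.+1 then (H ⊗ tpow H m : cocomCoalgType k) else k^o.

Section TensorPower.
Variables (k : fieldType) (H : cocomHopfType k).

(* h 0 ⊗ ... ⊗ h (n - 1) *)
Fixpoint pure (n : nat) (h : nat -> H) : tpow H n :=
  if n is m.+1 then h 0%N \ox pure m (fun j => h j.+1) else (1 : k^o).

(* h^1 ⊗ ... ⊗ h^n |-> h^1 ... h^l ε(h^(l+1)) ... ε(h^n), for l <= n;
   see [prod_mapE]. *)
Fixpoint prod_map (n l : nat) : {linear tpow H n -> H} :=
  match n, l with
  | m.+1, l'.+1 => @mulT k H \o tmap idfun (prod_map m l')
  | n, _ => @counit_one k (tpow H n) H
  end.

(* h^1 ⊗ ... ⊗ h^(n+1) |-> h^1 ⊗ ... ⊗ h^(i+1) h^(i+2) ⊗ ... ⊗ h^(n+1),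
   for i < n; see [merge_mapE]. *)
Fixpoint merge_map (n i : nat) : {linear tpow H n.+1 -> tpow H n} :=
  match n, i with
  | m.+1, i'.+1 => tmap idfun (merge_map m i')
  | m.+1, 0 => @mul_first k H (tpow H m)
  | 0, _ => @counit k (tpow H 1)
  end.

(* h^1 ⊗ ... ⊗ h^(n+1) |-> h^1 ⊗ ... ⊗ h^n ε(h^(n+1)); see [drop_lastE]. *)
Fixpoint drop_last (n : nat) : {linear tpow H n.+1 -> tpow H n} :=
  match n with
  | m.+1 => tmap idfun (drop_last m)
  | 0 => @counit k (tpow H 1)
  end.

Lemma counit_pure n h : counit (pure n h) = \prod_(j < n) counit (h j) :> k.
Proof.
elim: n h => [|n IH] h; first by rewrite big_ord0.
rewrite big_ord_recl /=; rewrite -[RHS]/(_ * _) -(IH (fun j => h j.+1)).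
by rewrite -tensor_counitE.
Qed.

Lemma prod_mapE n l h : (l <= n)%N -> prod_map n l (pure n h) =
  (\prod_(l <= j < n) (counit (h j) : k)) *: \prod_(0 <= j < l) h j.
Proof.
elim: n l h => [|n IH] [|l] h //= ln.
- by rewrite /counit_one !big_geq.
- rewrite /counit_one (counit_pure n.+1) big_mkord.
  by rewrite [\prod_(0 <= j < 0) _]big_geq.
- rewrite tmapE mulTE IH //= -scalerAr.
  by rewrite [\prod_(0 <= j < l.+1) _]big_nat_recl // big_add1.
Qed.

Lemma merge_mapE n i h : (i < n)%N -> merge_map n i (pure n.+1 h) =
  pure n (fun j => if (j < i)%N then h j
                   else if j == i then h i * h i.+1 else h j.+1).
Proof.
elim: n i h => [|n IH] // [|i] h ltin; first exact: mul_firstE.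
transitivity (h 0%N \ox merge_map n i (pure n.+1 (fun j => h j.+1))).
  exact: tmapE.
by rewrite IH.
Qed.

Lemma drop_lastE n h :
  drop_last n (pure n.+1 h) = (counit (h n) : k) *: pure n h.
Proof.
elim: n h => [|n IH] h; first by rewrite /= [LHS]tensor_counitE.
transitivity (h 0%N \ox drop_last n (pure n.+1 (fun j => h j.+1))).
  exact: tmapE.
by rewrite IH tensZr.
Qed.

Lemma prod_map_coalg_map n l : coalg_map (prod_map n l).
Proof.
elim: n l => [|n IH] [|l] /=; try exact: counit_one_coalg_map.
apply: comp_coalg_map (@mulT_coalg_map k H).
apply: (@tmap_coalg_map k H H (tpow H n) H); [exact: id_coalg_map | exact: IH].
Qed.

End TensorPower.

Section Cochains.
Variables (k : fieldType) (H : cocomHopfType k) (A : comAlgType k).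
Variable act : partial_action H A.
Local Notation Hom n := (conv_hom (tpow H n) A).

Definition act1 : {linear H -> A} :=
  mk_linear (lin_app act (lin_tensl 1 (@lin_id _ H))).

(* ((h^1 ... h^l) · 1) ε(h^(l+1)) ... ε(h^n), for l <= n; see [etildeE]. *)
Definition etilde (l n : nat) : Hom n := act1 \o prod_map H n l.

Definition epar (n : nat) : Hom n := \prod_(1 <= l < n.+1) etilde l n.

Definition in_ideal (n : nat) (f : Hom n) : Prop := exists u, f = epar n * u.

Definition is_cochain (n : nat) (f : Hom n) : Prop :=
  in_ideal f /\ exists g, in_ideal g /\ f * g = epar n.

(* C^n_par(H, A), the group of units of the ideal epar n * Hom_k(H^{⊗n}, A) *)
Record cochain (n : nat) := Cochain {
  cochain_val :> Hom n;
  cochainP : `[< is_cochain cochain_val >]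
}.

HB.instance Definition _ n := [isSub for @cochain_val n].
HB.instance Definition _ n := [Choice of cochain n by <:].

Lemma etilde_idem l n : etilde l n * etilde l n = etilde l n.
Proof.
apply: conv_homP => t; rewrite conv_mulE /= -[1 in RHS]mulr1 pactM.
rewrite (@prod_map_coalg_map k H n l t) sum_terms_sum /=; last by lina.
by apply: eq_bigr => p _; rewrite sum_tensE //; lina.
Qed.

Lemma e_idem n : epar n * epar n = epar n.
Proof. by rewrite -big_split; apply: eq_bigr => l _; apply: etilde_idem. Qed.

Lemma e_ideal n (f : Hom n) : in_ideal f -> epar n * f = f.
Proof. by case=> u ->; rewrite mulrA e_idem. Qed.

Fact cochain_one_subproof n : `[< is_cochain (epar n) >].
Proof.
have ie : in_ideal (epar n) by exists 1; rewrite mulr1.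
by apply/asboolP; split=> //; exists (epar n); split=> //; apply: e_idem.
Qed.
Definition cochain_one n := Cochain (cochain_one_subproof n).

Fact cochain_mul_subproof n (f g : cochain n) :
  `[< is_cochain (cochain_val f * cochain_val g) >].
Proof.
case: f g => f /= /asboolP [If [f' [If' ff']]] [g /= /asboolP [Ig [g' [Ig' gg']]]].
apply/asboolP; split; first by case: If => u ->; exists (u * g); rewrite mulrA.
exists (f' * g'); split; first by case: If' => u ->; exists (u * g'); rewrite mulrA.
by rewrite mulrACA ff' gg' e_idem.
Qed.
Definition cochain_mul n (f g : cochain n) : cochain n :=
  Cochain (cochain_mul_subproof f g).

Lemma cochain_inv_exists n (f : cochain n) :
  exists g : cochain n, cochain_val f * cochain_val g = epar n.
Proof.
case: f => f /= /asboolP [If [g [Ig fg]]].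
have Pg : `[< is_cochain g >].
  by apply/asboolP; split=> //; exists f; rewrite mulrC.
by exists (Cochain Pg).
Qed.
Definition cochain_inv n (f : cochain n) : cochain n :=
  projT1 (cid (cochain_inv_exists f)).

Lemma cochain_valI n : injective (@cochain_val n).
Proof. exact: val_inj. Qed.

Lemma cochain_mulV_val n (f : cochain n) :
  cochain_val f * cochain_val (cochain_inv f) = epar n.
Proof. exact: projT2 (cid (cochain_inv_exists f)). Qed.

Fact cochain_mulA n : associative (@cochain_mul n).
Proof. by move=> f g h; apply: cochain_valI; apply: mulrA. Qed.
Fact cochain_mul1 n : left_id (cochain_one n) (@cochain_mul n).
Proof.
by move=> f; apply/cochain_valI/e_ideal; case: f => f /= /asboolP [].
Qed.
Fact cochain_mulr1 n : right_id (cochain_one n) (@cochain_mul n).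
Proof.
by move=> f; rewrite -[RHS]cochain_mul1; apply/cochain_valI/mulrC.
Qed.
Fact cochain_mulV n :
  right_inverse (cochain_one n) (@cochain_inv n) (@cochain_mul n).
Proof. by move=> f; apply/cochain_valI/cochain_mulV_val. Qed.
Fact cochain_mulVl n :
  left_inverse (cochain_one n) (@cochain_inv n) (@cochain_mul n).
Proof.
by move=> f; rewrite -[RHS](cochain_mulV f); apply/cochain_valI/mulrC.
Qed.

HB.instance Definition _ n := isGroup.Build (cochain n) (@cochain_mulA n)
  (@cochain_mul1 n) (@cochain_mulr1 n) (@cochain_mulVl n) (@cochain_mulV n).

Lemma cochain_mulC n (f g : cochain n) : (f * g = g * f)%g.
Proof. exact/cochain_valI/mulrC. Qed.

(* f^((-1)^i) *)
Definition sign_pow n (i : nat) (f : cochain n) : cochain n :=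
  if odd i then (f^-1)%g else f.

(* h^1 ⊗ ... ⊗ h^(n+1) |-> h^1 · f(h^2 ⊗ ... ⊗ h^(n+1)) *)
Definition act_left n (f : Hom n) : Hom n.+1 :=
  (act \o tmap idfun f : {linear H ⊗ tpow H n -> A}).

(* The Sweedler components of the arguments h^1, ..., h^(n+1) are those of the
   coalgebra H^{⊗n+1}, so the defining formula of the coboundary is a
   convolution product of n + 2 linear maps on H^{⊗n+1}. *)
Definition delta n (f : cochain n) : Hom n.+1 :=
  act_left f * (\prod_(i < n) precomp (sign_pow i.+1 f) (merge_map H n i)) *
  precomp (sign_pow n.+1 f) (drop_last H n).

(* Hom_k(k, A) is identified with A through f |-> f 1. *)
Lemma hom0_mulE (f g : Hom 0) (a : k^o) :
  (f * g) a = (a : k) *: (f (1 : k^o) * g (1 : k^o)).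
Proof. by rewrite conv_mulE /coprod /= sum_base_coprod //; lina. Qed.

Lemma is_cochain0 (f : Hom 0) :
  is_cochain f <-> exists b : A, f (1 : k^o) * b = 1.
Proof.
have e0 : epar 0 = 1 by rewrite /epar big_geq.
rewrite /is_cochain /in_ideal e0.
split=> [[_ [g [_ /(congr1 (fun u : Hom 0 => u (1 : k^o)))]]]|[b fb]].
  rewrite hom0_mulE conv_oneE !scale1r => fg; exists (g (1 : k^o)).
  by rewrite fg.
split; first by exists f; rewrite mul1r.
have lb : linear (fun a : k^o => (a : k) *: b).
  by move=> a x y; rewrite scalerDl scalerA.
exists (mk_linear lb); split; first by exists (mk_linear lb); rewrite mul1r.
apply: conv_homP => a; by rewrite hom0_mulE conv_oneE /= scale1r fb.
Qed.

Lemma delta0E (f : cochain 0) (h : H) :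
  delta f (h \ox (1 : k^o)) =
  act (h \ox cochain_val f (1 : k^o)) * cochain_val (f^-1)%g (1 : k^o).
Proof.
rewrite /delta big_ord0 mulr1 conv_mulE /coprod /= sum_tensor_coprod; last first.
  by lina.
transitivity (\sum_(p <- terms (coprod h)) (counit p.2 : k) *:
  (act (p.1 \ox cochain_val f (1 : k^o)) * cochain_val (f^-1)%g (1 : k^o))).
  apply: eq_bigr => p _.
  rewrite sum_base_coprod /=; last by lina.
  rewrite scale1r tmapE [RHS]scalerAr; congr (_ * _).
  rewrite tensor_counitE.
  have -> : counit (1 : k^o) = 1 :> k by [].
  rewrite mulr1 -linearZ.
  by have -> : (counit p.2 : k) *: (1 : k^o) = counit p.2 by exact: mulr1.
have l : linear (fun x : H =>
    act (x \ox cochain_val f (1 : k^o)) * cochain_val (f^-1)%g (1 : k^o)) by lina.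
exact: (counitrE (mk_linear l) h).
Qed.

Lemma act_leftE n (f : Hom n) (h : H) (t : tpow H n) :
  act_left f (h \ox t) = act (h \ox f t).
Proof. by rewrite /= tmapE. Qed.


Lemma etildeE (l n : nat) (h : nat -> H) : (l <= n)%N ->
  etilde l n (pure n h) =
  (\prod_(l <= j < n) (counit (h j) : k)) *:
    act ((\prod_(0 <= j < l) h j) \ox 1).
Proof. by move=> ln; rewrite /= prod_mapE // tensZl linearZ. Qed.

End Cochains.

(* Main.v *)
Require Import Defs.
From HB Require Import structures.
From mathcomp Require Import all_boot all_order all_algebra.
From mathcomp Require Import boolp.
Set Implicit Arguments. Unset Strict Implicit. Unset Printing Implicit Defensive.
Import GRing.Theory.
Local Open Scope ring_scope.

(** The coboundary is a product, in the commutative convolution algebra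
    Hom(H^{⊗n+1}, A), of images of f and of its inverse under multiplicative
    maps: f |-> h^1 · f(h^2, ...) is multiplicative by (PA2), and precomposition
    with a morphism of coalgebras is multiplicative; merging two adjacent
    arguments is such a morphism because H is a bialgebra, and so is erasing
    the last one.  Hence delta is multiplicative ([deltaM]).

    Since the cochains form a group, the theorem then reduces to the value at
    the unit cochain e_n, namely delta(e_n) = e_{n+1} ([delta1]): it gives
    e_{n+1} * delta(f) = delta(e_n * f) = delta(f), so delta(f) is in the
    ideal, and delta(f) * delta(f^-1) = delta(e_n) = e_{n+1}.

    To compute delta(e_n), let x_l = (h^1 ... h^l) · 1, so that e_{n+1} is the
    product of the idempotents x_1, ..., x_{n+1}.  Merging arguments, or erasing
    the last one, carries each factor of e_n to some x_l, because a partial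
    product of merged arguments is a partial product of the original ones
    ([prod_map_merge], [prod_map_drop_last]); by idempotency e_{n+1} absorbs
    such factors ([precomp_epar_absorb]).  By (PA3) the remaining factor
    h^1 · e_n(h^2, ...) multiplies each (h^2 ... h^l) · 1 into x_1 * x_l, so it
    is exactly e_{n+1} ([act_left_epar]).

    The empty partial product gives x_0 = 1, by (PA1).  Letting the products
    start at l = 0 treats preservation of the counit together with the other
    factors, and makes n = 0 an instance of the general case. *)

(** * Morphisms of coalgebras and convolution *)

Section TensorExtensionality.
Variables (k : fieldType).

Lemma tens3_ext (U V W X : lmodType k) (f g : tensor U (tensor V W) -> X) :
  linear f -> linear g ->
  (forall u v w, f (u \ox (v \ox w)) = g (u \ox (v \ox w))) -> f =1 g.
Proof.
move=> lf lg fg; apply: tens_ext => // u.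
have lr : linear (fun x : tensor V W => u \ox x) by lina.
by apply: tens_ext => [a x y|a x y|v w]; rewrite ?lr ?lf ?lg ?fg.
Qed.

End TensorExtensionality.

Section CoalgebraMaps.
Variables (k : fieldType).

Lemma counit_coalg_map (C : coalgType k) :
  coalg_map (counit : {linear C -> k^o}).
Proof.
move=> c; rewrite /coprod /= /base_coprod.
have l : linear (fun x : C => (1 : k^o) \ox (counit x : k^o)) by lina.
transitivity ((1 : k^o) \ox (counit c : k^o)).
  rewrite -tensZr; congr (_ \ox _); exact: mulr1.
rewrite -[LHS]/(mk_linear l c) -(counitlE (mk_linear l)) /=.
apply: eq_bigr => p _; apply: etrans (esym (tensZl _ _ _)) _.
by congr (_ \ox _); exact: mulr1.
Qed.

(** The reason is multiplicativity of the coproduct of H. *)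
Lemma mul_first_coalg_map (H : bialgType k) (D : coalgType k) :
  coalg_map (@mul_first k H D : {linear H ⊗ (H ⊗ D) -> H ⊗ D}).
Proof.
apply: tens3_ext; [by move=> a x y; rewrite !linearP|by lina|] => x y t /=.
rewrite mul_firstE /coprod /= tensor_coprodE coprodM.
rewrite sum_terms_sum /=; last by lina.
rewrite sum_tensor_coprod /=; last by lina.
apply: eq_bigr => p _.
rewrite sum_terms_sum /=; last by lina.
rewrite sum_tensor_coprod /=; last by lina.
apply: eq_bigr => q _.
rewrite sum_tensE /=; last by lina.
by apply: eq_bigr => r _; rewrite !mul_firstE.
Qed.

Lemma merge_map_coalg_map (H : cocomHopfType k) n i :
  coalg_map (Defs.merge_map H n i).
Proof.
elim: n i => [|n IH] [|i]; try exact: counit_coalg_map.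
  exact: mul_first_coalg_map.
exact: (@tmap_coalg_map k H H (tpow H n.+1) (tpow H n) idfun (Defs.merge_map H n i)
  (id_coalg_map (C := H)) (IH i)).
Qed.

Lemma drop_last_coalg_map (H : cocomHopfType k) n :
  coalg_map (drop_last H n).
Proof.
elim: n => [|n IH]; first exact: counit_coalg_map.
exact: (@tmap_coalg_map k H H (tpow H n.+1) (tpow H n) idfun (drop_last H n)
  (id_coalg_map (C := H)) IH).
Qed.

(** The counit retracts the unit map of a bialgebra. *)
Lemma scale1_inj (H : bialgType k) (a b : k) : a *: (1 : H) = b *: 1 -> a = b.
Proof.
move=> /(congr1 counit); rewrite !linearZ /= counit1 => ab.
by rewrite -(mulr1 a) -(mulr1 b).
Qed.

Lemma precompM (C D : coalgType k) (A : comAlgType k) (phi : {linear C -> D})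
    (f g : conv_hom D A) :
  coalg_map phi -> precomp (f * g) phi = precomp f phi * precomp g phi.
Proof.
move=> cphi; apply: conv_homP => c; rewrite conv_mulE.
rewrite -[LHS]/((f * g) (phi c)) conv_mulE cphi.
rewrite sum_terms_sum /=; last by lina.
by apply: eq_bigr => p _; rewrite sum_tensE //; lina.
Qed.

End CoalgebraMaps.

(** * Partial products of merged arguments *)

Section PartialProducts.
Variables (k : fieldType) (H : cocomHopfType k).

Lemma prod_map0E n (t : tpow H n) : prod_map H n 0 t = (counit t : k) *: (1 : H).
Proof. by case: n t. Qed.

Lemma prod_map_consE n l (h : H) (t : tpow H n) :
  prod_map H n.+1 l.+1 (h \ox t) = h * prod_map H n l t.
Proof. by rewrite /= tmapE mulTE. Qed.

Lemma counit_consE n (h : H) (t : tpow H n) :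
  counit (h \ox t : tpow H n.+1) = counit h * counit t :> k.
Proof. exact: tensor_counitE. Qed.

(** Merging h^(i+1) and h^(i+2) does not affect the products h^1 ... h^l that
    stop before the merged factor, that is with l <= i; a longer one has one
    more factor when written in the original arguments.  The product
    h^1 ... h^(i+1) is the only one that is not reached.
    For l = 0 this says that merging preserves the counit. *)
Lemma prod_map_merge n i l (t : tpow H n.+1) : (i < n)%N ->
  prod_map H n l (Defs.merge_map H n i t) =
  prod_map H n.+1 (if (l <= i)%N then l else l.+1) t.
Proof.
elim: n i l t => [|n IH] // [|i] l t ltin; last first.
  move: t; apply: tens_ext; [by move=> a x y; rewrite !linearP..|] => h t.
  have mE : Defs.merge_map H n.+1 i.+1 (h \ox t) = h \ox Defs.merge_map H n i t.
    exact: tmapE.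
  rewrite mE; case: l => [|l]; last first.
    by rewrite prod_map_consE IH // ltnS; case: ifP => _; rewrite -prod_map_consE.
  rewrite leq0n !prod_map0E !counit_consE; congr (_ * _ *: _).
  by have := IH i 0%N t ltin; rewrite leq0n !prod_map0E => /scale1_inj.
move: t; apply: tens3_ext; [by move=> a x y; rewrite !linearP..|] => x y t.
have mE : Defs.merge_map H n.+1 0 (x \ox (y \ox t)) = (x * y) \ox t.
  exact: mul_firstE.
rewrite mE; case: l => [|l].
  by rewrite !prod_map0E counit_consE (counit_consE (n := n.+1)) counit_consE
    counitM mulrA.
by rewrite prod_map_consE (prod_map_consE (n := n.+1)) prod_map_consE mulrA.
Qed.

Lemma prod_map_drop_last n l (t : tpow H n.+1) : (l <= n)%N ->
  prod_map H n l (drop_last H n t) = prod_map H n.+1 l t.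
Proof.
elim: n l t => [|n IH] l t.
  by rewrite leqn0 => /eqP ->; rewrite !prod_map0E.
move=> ln; move: t; apply: tens_ext;
  [by move=> a x y; rewrite !linearP..|] => h t.
have dE : drop_last H n.+1 (h \ox t) = h \ox drop_last H n t by exact: tmapE.
rewrite dE; case: l ln => [|l] ln; last first.
  by rewrite !(prod_map_consE, prod_map_consE (n := n.+1)) IH.
rewrite !prod_map0E counit_consE (counit_consE (n := n.+1)).
congr (_ * _ *: _).
by have := IH 0%N t (leq0n n); rewrite !prod_map0E => /scale1_inj.
Qed.

End PartialProducts.

(** * The coboundary of the unit cochain and its multiplicativity *)

Section Coboundary.
Variables (k : fieldType) (H : cocomHopfType k) (A : comAlgType k).
Variable act : partial_action H A.
Local Notation Hom n := (conv_hom (tpow H n) A).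

Lemma etilde0 n : etilde act 0 n = 1.
Proof.
apply: conv_homP => t; rewrite conv_oneE /= -[_ t]/(prod_map H n 0 t).
by rewrite prod_map0E tensZl linearZ /= pact1.
Qed.

Lemma eparE n : epar act n = \prod_(0 <= l < n.+1) etilde act l n.
Proof. by rewrite big_nat_recl // etilde0 mul1r /epar big_add1. Qed.

Lemma etilde_absorb n l : (l <= n)%N ->
  etilde act l n * epar act n = epar act n.
Proof.
move=> ln; rewrite eparE (bigD1_seq l) ?mem_index_iota ?iota_uniq //=.
by rewrite mulrA etilde_idem.
Qed.

(** If phi carries every factor of epar n to a factor of epar m or to the unit
    (l' = 0), then each of the images is absorbed in turn, by idempotency. *)
Lemma precomp_epar_absorb m n (phi : {linear tpow H m -> tpow H n}) :
  coalg_map phi ->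
  (forall l, (l <= n)%N -> exists2 l', (l' <= m)%N &
     forall t, prod_map H n l (phi t) = prod_map H m l' t) ->
  precomp (epar act n) phi * epar act m = epar act m.
Proof.
move=> cphi Ephi; rewrite eparE.
have absorb l : (l <= n)%N ->
    precomp (etilde act l n) phi * epar act m = epar act m.
  move=> /Ephi [l' l'm E].
  rewrite -[RHS](etilde_absorb l'm); congr (_ * _).
  by apply: conv_homP => t; rewrite /= E.
(* The upper bound of the product moves while the arity n stays fixed. *)
suff partial j : (j <= n)%N ->
    precomp (\prod_(0 <= l < j.+1) etilde act l n) phi * epar act m =
    epar act m by exact: partial.
elim: j => [|j IH] jn; first by rewrite big_nat1 absorb.
rewrite big_nat_recr //= precompM // -mulrA absorb // IH //.
exact: ltnW.
Qed.

(** Axiom (PA2), applied to each term of the convolution product. *)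
Lemma act_leftM n (f g : Hom n) :
  act_left act (f * g) = act_left act f * act_left act g.
Proof.
apply: conv_homP; apply: tens_ext;
  [by move=> a x y; rewrite linearP..|] => h t.
rewrite act_leftE !conv_mulE.
rewrite [in RHS]/coprod /= sum_tensor_coprod /=; last by lina.
under [RHS]eq_bigr => p _ do under eq_bigr => q _ do rewrite !tmapE.
rewrite exchange_big.
have la (x : H) : linear (fun a : A => x \ox a) by lina.
rewrite -[_ \ox _]/(mk_linear (la h) _) !linear_sum /=.
by apply: eq_bigr => q _; rewrite pactM.
Qed.

(** Axiom (PA3) with a = 1: the factor h^1 · 1 that a partial action produces
    is etilde 1. *)
Lemma act_left_etilde n l :
  act_left act (etilde act l n) = etilde act 1 n.+1 * etilde act l.+1 n.+1.
Proof.
apply: conv_homP; apply: tens_ext;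
  [by move=> a x y; rewrite linearP..|] => h t.
rewrite act_leftE conv_mulE.
rewrite [in RHS]/coprod /= sum_tensor_coprod /=; last by lina.
rewrite pactA; apply: eq_bigr => p _.
under eq_bigr => q _ do rewrite !tmapE !mulTE /=.
(* etilde 1 keeps h^1 and applies the counit to the other arguments. *)
have E (x : tpow H n) : prod_map H n 0 x = (counit x : k) *: (1 : H) by exact: prod_map0E.
under eq_bigr => q _ do
  rewrite E -scalerAr mulr1 tensZl linearZ -scalerAl.
have lG : linear (fun x : tpow H n =>
  act (p.1 \ox 1) * act ((p.2 * prod_map H n l x) \ox 1)) by lina.
by rewrite (counitlE (mk_linear lG)).
Qed.

(** The factors etilde 1 produced by [act_left_etilde] collapse to a single one.
    It is the first factor of epar n.+1, and comes from l = 0. *)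
Lemma act_left_epar n : act_left act (epar act n) = epar act n.+1.
Proof.
rewrite eparE.
suff partial j : act_left act (\prod_(0 <= l < j.+1) etilde act l n) =
    \prod_(1 <= l < j.+2) etilde act l n.+1 by exact: partial.
elim: j => [|j IH].
  by rewrite !big_nat1 act_left_etilde etilde_idem.
rewrite big_nat_recr // act_leftM IH act_left_etilde.
rewrite [RHS]big_nat_recr // mulrA; congr (_ * _).
by rewrite big_ltn // mulrAC etilde_idem.
Qed.

Lemma precomp_merge_absorb n i : (i < n)%N ->
  precomp (epar act n) (Defs.merge_map H n i) * epar act n.+1 = epar act n.+1.
Proof.
move=> ltin; apply: precomp_epar_absorb; first exact: merge_map_coalg_map.
move=> l ln; exists (if (l <= i)%N then l else l.+1) => [|t].
  by case: ifP => // _; exact: leqW.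
exact: prod_map_merge.
Qed.

Lemma precomp_drop_last_absorb n :
  precomp (epar act n) (drop_last H n) * epar act n.+1 = epar act n.+1.
Proof.
apply: precomp_epar_absorb; first exact: drop_last_coalg_map.
by move=> l ln; exists l => [|t]; [exact: leqW | exact: prod_map_drop_last].
Qed.

Lemma sign_powM n i (f g : cochain act n) :
  sign_pow i (f * g)%g = (sign_pow i f * sign_pow i g)%g.
Proof. by rewrite /sign_pow; case: odd; rewrite // invgM cochain_mulC. Qed.

Lemma sign_pow1 n i : sign_pow i (1%g : cochain act n) = 1%g.
Proof. by rewrite /sign_pow invg1 if_same. Qed.

(** Inversion is multiplicative because the cochain group is abelian, hence so
    is each factor of delta. *)
Lemma deltaM n (f g : cochain act n) : delta (f * g)%g = delta f * delta g.
Proof.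
rewrite /delta sign_powM precompM; last exact: drop_last_coalg_map.
under eq_bigr => i _ do
  rewrite sign_powM (precompM _ _ (@merge_map_coalg_map k H n i)).
rewrite big_split act_leftM (mulrACA (act_left act f)).
exact: mulrACA.
Qed.

Lemma delta1 n : delta (1%g : cochain act n) = epar act n.+1.
Proof.
rewrite /delta act_left_epar mulrC sign_pow1 mulrA precomp_drop_last_absorb.
rewrite mulrC; apply: (big_ind (fun x => x * epar act n.+1 = epar act n.+1)).
- exact: mul1r.
- by move=> x y ex ey; rewrite -mulrA ey.
- by move=> i _; rewrite sign_pow1 precomp_merge_absorb.
Qed.

(** The membership in the ideal and the inverse both come from [delta1], applied
    to 1 * f = f and to f * f^-1 = 1. *)
Lemma delta_cochain n (f : cochain act n) : is_cochain act (delta f).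
Proof.
have ideal (g : cochain act n) : in_ideal act (delta g).
  by exists (delta g); rewrite -delta1 -deltaM mul1g.
by split=> //; exists (delta f^-1)%g; rewrite -deltaM mulgV delta1.
Qed.

End Coboundary.

Theorem theorem3p9 (k : fieldType) (H : cocomHopfType k) (A : comAlgType k)
    (act : partial_action H A) (n : nat) :
  (forall f : cochain act n, is_cochain act (delta f)) /\
  exists d : cochain act n -> cochain act n.+1,
    (forall f : cochain act n, cochain_val (d f) = delta f) /\
    (forall f g : cochain act n, d (f * g)%g = (d f * d g)%g).
Proof.
split; first exact: delta_cochain.
exists (fun f => Cochain (asboolT (delta_cochain f))); split=> // f g.
exact/cochain_valI/deltaM.
Qed.
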